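(* Suppose that $f$ is bilipschitz on $T=\mathbb T_q$ with respect to $\rho$, i.e. $f$ is a map from $T$ onto itself and there is a constant $C$ such that $$e^{-C}\rho(f(x),f(y))\le\rho(x,y)\le e^{C}\rho(f(x),f(y))\qquad\text{for all }x,y\in T.$$ Then, with this $C$, $$-C\le\ell(x)-\ell(f(x))\le C\qquad\text{for all }x\in T.$$ In particular, $J_f,\,1/J_f\in L^\infty(T)$ and thus $J_f\in A_p(\mu)$ for every $p\in[1,\infty]$.
   Context: $T=\mathbb T_q$ is (the vertex set of) the homogeneous tree of order $q+1$ ($q\ge1$ an integer): every vertex has exactly $q+1$ neighbours. $d$ is the geodesic distance. $\partial T$ is the boundary of $T$ (equivalence classes of semi-infinite geodesics, two being equivalent if they eventually coincide). Fix $\omega_*\in\partial T$; $[x,\omega_* )$ is the semi-infinite geodesic from $x$ to $\omega_*$, and $x\le y$ means $y\in[x,\omega_* )$. Fix $o\in T$, enumerate $[o,\omega_* )=\{x_j\}_{j\in\mathbb N}$ with $x_0=o$ and $d(x_j,x_k)=|j-k|$, and define the level $\ell(x)=\lim_{j\to\infty}(j-d(x,x_j))$. The canonical flow measure is $\mu(x)=q^{\ell(x)}$, and $\mu(E)=\sum_{y\in E}\mu(y)$. For a bijection $f$ of $T$ onto itself, $J_f(x)=\mu(f(x))/\mu(x)$. The confluent $x\wedge y$ of $x,y\in T$ is the vertex $z$ of minimum level with $x\le z$ and $y\le z$. The Gromov distance is $\rho(x,y)=e^{\ell(x\wedge y)}$ if $x\ne y$ and $\rho(x,x)=0$. Fix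 a number $\beta\ge12$. For $x\in T$ and $h_1,h_2\in\mathbb N$, $h_1<h_2$, let $R_{h_1}^{h_2}(x)=\{y\in T:y\le x,\ h_1\le d(x,y)<h_2\}$; it is an admissible trapezoid if $2\le h_2/h_1\le\beta$. $\mathcal R$ is the family of all admissible trapezoids and all singletons. For a positive function $w$ on $T$: $w\in A_p(\mu)$, $p\in(1,\infty)$, means $$\sup_{R\in\mathcal R}\Big(\frac1{\mu(R)}\sum_{y\in R}w(y)\mu(y)\Big)\Big(\frac1{\mu(R)}\sum_{y\in R}w(y)^{-1/(p-1)}\mu(y)\Big)^{p-1}<\infty;$$ $w\in A_1(\mu)$ means $\sup_{R\in\mathcal R}\big(\frac1{\mu(R)}\sum_{y\in R}w(y)\mu(y)\big)\|w^{-1}\|_{L^\infty(R)}<\infty$; and $A_\infty(\mu)=\bigcup_{p>1}A_p(\mu)$. *)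

(* Defs.v *)
From mathcomp Require Import all_boot all_order all_algebra.
From mathcomp Require Import all_classical all_reals all_analysis.
Set Implicit Arguments.
Unset Strict Implicit.
Unset Printing Implicit Defensive.
Import Order.TTheory GRing.Theory Num.Theory.
Import numFieldNormedType.Exports.
Local Open Scope classical_set_scope.
Local Open Scope ring_scope.

(* The homogeneous tree of order q + 1 is unique up to isomorphism; it is
   specified here by its axioms, so that statements about [T : homTree q] hold
   in every model of it. [ucycle adj c] says that the vertices listed in [c] are
   distinct and that [c] is a closed walk; an edge, traversed back and forth, is
   such a [c] of size 2. *)
Record homTree (q : nat) := HomTree {
  vertex :> choiceType;
  adj : rel vertex;
  adj_sym : symmetric adj;
  adj_irr : irreflexive adj;
  adj_connected : forall x y, exists2 p, path adj x p & last x p = y;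
  adj_acyclic : forall c : seq vertex, ucycle adj c -> (size c <= 2)%N;
  adj_degree : forall x, ([set y | adj x y] #= `I_q.+1)%card }.

Section Tree.
Variables (q : nat) (T : homTree q).

Definition walk_lengths (x y : T) : set nat :=
  [set n | exists p, [/\ path (@adj q T) x p, last x p = y & size p = n]].

(* The default value 0 of [xget] is irrelevant, since T is connected. *)
Definition dist (x y : T) : nat :=
  xget 0%N [set n | walk_lengths x y n /\
                    forall m, walk_lengths x y m -> (n <= m)%N].

Definition is_ray (g : nat -> T) : Prop :=
  forall j k : nat, dist (g j) (g k) = `|j%:Z - k%:Z|%N.

(* "Eventually coincide" is understood up to a shift of the parameter, because
   rays are here parametrized by nat from their starting vertex. *)
Definition ray_equiv (g g' : nat -> T) : Prop :=
  exists m n, forall k, g (m + k)%N = g' (n + k)%N.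

Record boundary := Boundary {
  rays : set (nat -> T);
  raysP : exists2 g, is_ray g & rays = [set g' | is_ray g' /\ ray_equiv g g'] }.

Variable omega : boundary.

(* [x, omega), parametrized from x: the unique ray of the class omega that
   starts at x (the default value of [xget] is irrelevant). *)
Definition geod (x : T) : nat -> T :=
  xget (fun=> x) [set g | rays omega g /\ g 0%N = x].

Definition tle (x y : T) : Prop := range (geod x) y.

End Tree.

Section FlowMeasure.
Variables (R : realType) (q : nat) (T : homTree q).
Variables (omega : boundary T) (o : T).

Definition level (x : T) : R :=
  limn (fun j : nat => j%:R - (dist x (geod omega o j))%:R : R).

Definition mu (x : T) : R := q%:R `^ level x.

Definition mu_set (E : set T) : \bar R := \esum_(y in E) (mu y)%:E.

Definition flow_jacobian (f : T -> T) (x : T) : R := mu (f x) / mu x.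

Definition is_confluent (x y z : T) : Prop :=
  [/\ tle omega x z, tle omega y z &
      forall z', tle omega x z' -> tle omega y z' -> level z <= level z'].

Definition confluent (x y : T) : T := xget x [set z | is_confluent x y z].

Definition gromov (x y : T) : R :=
  if x == y then 0 else expR (level (confluent x y)).

Definition bilipschitz (C : R) (f : T -> T) : Prop :=
  (forall y, exists x, f x = y) /\
  forall x y,
    expR (- C) * gromov (f x) (f y) <= gromov x y
                                    <= expR C * gromov (f x) (f y).

Definition trapezoid (h1 h2 : nat) (x : T) : set T :=
  [set y | tle omega y x /\ (h1 <= dist x y < h2)%N].

(* The condition 0 < h1 is the one under which h2 / h1 makes sense. *)
Definition admissible_height (beta : R) (h1 h2 : nat) : Prop :=
  [/\ (0 < h1)%N, (h1 < h2)%N & 2 <= (h2%:R / h1%:R : R) <= beta].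

Definition admissible (beta : R) : set (set T) :=
  [set E | (exists x h1 h2, admissible_height beta h1 h2 /\
                            E = trapezoid h1 h2 x)
           \/ exists x, E = [set x]].

Local Open Scope ereal_scope.

(* For nonnegative u; the members of [admissible beta] are finite and
   nonempty, so on them the quotient is that of two positive reals. *)
Definition average (u : T -> R) (E : set T) : \bar R :=
  (mu_set E)^-1 * \esum_(y in E) (u y * mu y)%:E.

(* Norm of L^oo(E) with respect to mu: every vertex has positive mass, so the
   essential supremum is a supremum. *)
Definition Loo_norm (u : T -> R) (E : set T) : \bar R :=
  ereal_sup [set `|u y|%:E | y in E].

Definition in_Loo (u : T -> R) : Prop := Loo_norm u setT < +oo.

Definition positive_weight (w : T -> R) : Prop := forall x, (0 < w x)%R.

(* A_p for 1 < p < +oo *)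
Definition Ar (beta p : R) (w : T -> R) : Prop :=
  positive_weight w /\
  ereal_sup [set average w E *
                 average (fun y => w y `^ (- (p - 1)^-1))%R E `^ (p - 1)
            | E in admissible beta] < +oo.

Definition A1 (beta : R) (w : T -> R) : Prop :=
  positive_weight w /\
  ereal_sup [set average w E * Loo_norm (fun y => (w y)^-1)%R E
            | E in admissible beta] < +oo.

Definition Aoo (beta : R) (w : T -> R) : Prop :=
  exists2 p : R, (1 < p)%R & Ar beta p w.

(* Only meaningful for 1 <= p. *)
Definition Ap (beta : R) (p : \bar R) (w : T -> R) : Prop :=
  match p with
  | r%:E => if r == 1%R then A1 beta w else Ar beta r w
  | +oo => Aoo beta w
  | -oo => False
  end.

End FlowMeasure.

(* Main.v *)
Require Import Defs.
From mathcomp Require Import all_boot all_order all_algebra.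
From mathcomp Require Import all_classical all_reals all_analysis.
From mathcomp Require Import ring.
Import Order.TTheory GRing.Theory Num.Theory.
Import numFieldNormedType.Exports.
Local Open Scope classical_set_scope.
Local Open Scope ring_scope.

(** Any vertex [y] other than [x] satisfies
    [gromov x y = exp (level (x /\ y)) >= exp (level x)], because the confluent
    lies above [x] and levels increase towards the boundary point. Equality
    holds for any [y <> x] below [x], and one exists because [q >= 1]. Hence
    [exp (level x)] is the minimum of the Gromov distances from [x] to other
    vertices ([gromov_ge], [gromov_tle]). A bilipschitz bijection distorts each
    of these distances by a factor at most [exp C], hence also their minimum:
    the levels of [x] and [f x] differ by at most [C] ([bilipschitz_level]).

    What this asks of the tree is that levels increase along rays
    ([level_geod]) and that every vertex has another one below it
    ([tle_exists_lt]). Both rest on the uniqueness of simple paths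
    ([simple_path_unique]): it makes simple paths geodesic, so that a ray can be
    prolonged backwards by any neighbour of its origin off the ray ([ray_cons]),
    and it makes the ray from a vertex to the boundary point unique
    ([equiv_ray_unique]).

    Finally the Jacobian is [q] to the power [level (f x) - level x], so it and
    its inverse are at most [q ^ C]. A weight bounded together with its inverse
    lies in every Muckenhoupt class, since each factor in the supremum defining
    the class is then bounded ([bounded_Ap]). *)

(** * Simple paths, distance and rays *)

Section Geodesics.
Context {q : nat} {T : homTree q}.
Implicit Types (x y : T) (p : seq T) (g h : nat -> T).
Local Open Scope nat_scope.

(** If the paths leave [x] through distinct neighbours, let [c] be the first
    vertex after [x] of the second path that lies on the first one. Following
    the first path up to [c], then the second one back to [x], gives a simple
    closed walk, of size at least 3 because the neighbours are distinct. *)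
Lemma simple_path_unique x p1 p2 :
  path (@adj q T) x p1 -> path (@adj q T) x p2 ->
  uniq (x :: p1) -> uniq (x :: p2) -> last x p1 = last x p2 -> p1 = p2.
Proof.
elim: p1 x p2 => [|a p1 IH] x [|b p2] //.
- by move=> _ _ _ /andP[+ _] /= xE; rewrite {1}xE mem_last.
- by move=> _ _ /andP[+ _] _ /= xE; rewrite -{1}xE mem_last.
have [<-{b}|a_neq_b] := eqVneq a b.
  move=> /andP[_ path1] /andP[_ path2] /andP[_ uniq1] /andP[_ uniq2] /= eq_last.
  by rewrite (IH a p2).
move=> path1 path2 uniq1 uniq2 eq_last; exfalso.
have {eq_last} meet : has [in a :: p1] (b :: p2).
  apply/hasP; exists (last b p2); first exact: mem_last.
  by move: eq_last => /= <-; exact: mem_last.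
(* Written as the heads of the two paths, [a] and [b] follow the splittings. *)
move: a_neq_b; rewrite -[b]/(head b (b :: p2)) -[a]/(head a (a :: p1)).
case: (split_find meet) path2 uniq2 => c l2 r2 c_in_p1 l2_out_p1.
rewrite cat_path -cat_cons cat_uniq => /andP[path2 _] /andP[uniq2 _].
case: (path.splitP c_in_p1) path1 uniq1 l2_out_p1 => l1 r1.
rewrite cat_path -cat_cons cat_uniq => /andP[path1 _] /andP[uniq1 _] disj.
have : ucycle (@adj q T) (x :: rcons l1 c ++ rev l2).
  apply/andP; split.
    rewrite /= rcons_cat cat_path path1 last_rcons /= -rev_cons.
    have := rev_path (@adj q T) x (rcons l2 c).
    rewrite last_rcons belast_rcons => ->.
    by rewrite (eq_path (e' := @adj q T)) // => u v; exact: adj_sym.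
  rewrite -cat_cons cat_uniq uniq1 rev_uniq has_rev.
  move: uniq2; rewrite /= rcons_uniq mem_rcons inE negb_or.
  move=> /andP[/andP[_ x_notin] /andP[_ ->]]; rewrite andbT.
  apply/hasPn => u u_in; rewrite /= inE negb_or; apply/andP; split.
    by apply: contraNneq x_notin => <-.
  by apply: contra (hasPn disj _ u_in) => u_l1; rewrite mem_cat u_l1.
move=> /adj_acyclic; rewrite /= size_cat size_rcons size_rev.
case: l1 l2 {path1 uniq1 path2 uniq2 disj} => [|? ?] [|? ?] //=.
by rewrite eqxx.
Qed.

Lemma distP x y : walk_lengths x y (dist x y) /\
  forall n, walk_lengths x y n -> dist x y <= n.
Proof.
have [p xp py] := adj_connected x y.
have ex_walk : exists n, `[< walk_lengths x y n >].
  by exists (size p); apply/asboolP; exists p.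
apply: (xgetPex 0 (P := [set n | walk_lengths x y n /\
  forall m, walk_lengths x y m -> n <= m])); exists (ex_minn ex_walk).
case: ex_minnP => m /asboolP walk_m min_m; split => // k walk_k.
by apply: min_m; apply/asboolP.
Qed.

Lemma dist_walk x y : walk_lengths x y (dist x y).
Proof. by have [] := distP x y. Qed.

Lemma dist_min x y n : walk_lengths x y n -> dist x y <= n.
Proof. by have [_] := distP x y; apply. Qed.

(** A shortest walk can be shortened to a simple one with the same ends, and
    there is only one of these. *)
Lemma dist_simple_path x p :
  path (@adj q T) x p -> uniq (x :: p) -> dist x (last x p) = size p.
Proof.
move=> xp uniq_p; apply/eqP; rewrite eqn_leq dist_min; last by exists p.
have [r [xr rE <-]] := dist_walk x (last x p).
case: (shortenP xr) rE => r' xr' uniq_r' sub_r' r'E.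
rewrite (simple_path_unique _ _ _ xp xr' uniq_p uniq_r') //.
by apply: uniq_leq_size; [case/andP: uniq_r'|exact: sub_r'].
Qed.

Lemma dist_sym x y : dist x y = dist y x.
Proof.
suff le_dist (u v : T) : dist u v <= dist v u.
  by apply/eqP; rewrite eqn_leq !le_dist.
have [p [vp <- <-]] := dist_walk v u; apply: dist_min.
exists (rev (belast v p)); split; last by rewrite size_rev size_belast.
  by rewrite rev_path (eq_path (e' := @adj q T)) // => a b; exact: adj_sym.
by case: p {vp} => //= a p; rewrite rev_cons last_rcons.
Qed.

Lemma distxx x : dist x x = 0.
Proof. by apply/eqP; rewrite -leqn0 dist_min //; exists [::]. Qed.

Lemma dist_adj x y : adj x y -> dist x y <= 1.
Proof. by move=> xy; apply: dist_min; exists [:: y]; rewrite /= xy. Qed.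

Lemma dist1_adj x y : dist x y = 1 -> adj x y.
Proof.
by have [[|a [|? ?]] [+ + <-]] // := dist_walk x y; rewrite /= andbT => ? <-.
Qed.

Lemma path_sequence g i n : (forall j, adj (g j) (g j.+1)) ->
  path (@adj q T) (g i) [seq g j | j <- iota i.+1 n].
Proof. by move=> adj_g; elim: n i => //= n IH i; rewrite adj_g IH. Qed.

Lemma last_sequence g i n : last (g i) [seq g j | j <- iota i.+1 n] = g (i + n).
Proof. by elim: n i => [|n IH] i /=; rewrite ?addn0 // IH addSnnS. Qed.

Lemma ray_inj g : is_ray g -> injective g.
Proof.
by move=> ray_g i j gij; apply/eqP; rewrite -distn_eq0 -ray_g gij distxx.
Qed.

Lemma ray_adj g : is_ray g -> forall j, adj (g j) (g j.+1).
Proof. by move=> ray_g j; apply: dist1_adj; rewrite ray_g distnS. Qed.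

(** In a tree, local steps and injectivity suffice, since simple paths are
    geodesics. *)
Lemma is_rayP g : is_ray g <-> injective g /\ forall j, adj (g j) (g j.+1).
Proof.
split=> [ray_g|[inj_g adj_g] j k].
  by split; [exact: ray_inj|exact: ray_adj].
wlog le_jk : j k / j <= k.
  by case/orP: (leq_total j k) => /[swap] wl /wl; rewrite // dist_sym distnC.
rewrite distnEr // -{1}(subnKC le_jk) -last_sequence dist_simple_path.
- by rewrite size_map size_iota.
- exact: path_sequence.
- rewrite -map_cons (map_inj_uniq inj_g).
  exact: (iota_uniq j (k - j).+1).
Qed.

Definition cons_ray x g (n : nat) : T := if n is n'.+1 then g n' else x.

Lemma ray_shift g i : is_ray g -> is_ray (fun n => g (i + n)).
Proof. by move=> ray_g j k; rewrite ray_g distnDl. Qed.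

Lemma ray_cons x g : is_ray g -> adj x (g 0) -> x <> g 1 ->
  is_ray (cons_ray x g).
Proof.
move=> ray_g adj_x x_neq; apply/is_rayP; split; last first.
  by case=> //= j; exact: ray_adj.
have x_notin n : x <> g n.
  case: n => [|[|n]] // xE; first by rewrite -xE adj_irr in adj_x.
  by have := dist_adj _ _ adj_x; rewrite xE ray_g distn0.
move=> [|i] [|j] //= => [|gE|gij]; first by move=> /x_notin.
  by case: (x_notin i).
by rewrite (ray_inj _ ray_g _ _ gij).
Qed.

(** Both rays move away from their common origin at unit speed, so they meet
    at equal times; up to the meeting time they are simple paths with the same
    ends. *)
Lemma equiv_ray_unique g h a b : is_ray g -> is_ray h -> g 0 = h 0 ->
  (forall k, g (a + k) = h (b + k)) -> g =1 h.
Proof.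
move=> ray_g ray_h gh0 tails.
have ab k : a + k = b + k.
  by rewrite -(distn0 (a + k)) -ray_g tails gh0 ray_h distn0.
have {}ab : a = b by have := ab 0; rewrite !addn0.
move: tails; rewrite -{b}ab => tails.
have prefix : [seq g j | j <- iota 1 a] = [seq h j | j <- iota 1 a].
  apply: (simple_path_unique (g 0)).
  - exact: (path_sequence g 0 a (ray_adj _ ray_g)).
  - by rewrite gh0; exact: (path_sequence h 0 a (ray_adj _ ray_h)).
  - rewrite -map_cons (map_inj_uniq (ray_inj _ ray_g)).
    exact: (iota_uniq 0 a.+1).
  - rewrite gh0 -map_cons (map_inj_uniq (ray_inj _ ray_h)).
    exact: (iota_uniq 0 a.+1).
  - have /= -> := last_sequence g 0 a; rewrite gh0.
    by have /= -> := last_sequence h 0 a; have := tails 0; rewrite !addn0.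
move=> [//|n]; case: (leqP a n.+1) => [le_an|lt_na].
  by rewrite -(subnKC le_an) tails.
have := congr1 (nth (g 0) ^~ n) prefix.
by rewrite !(nth_map 0) ?size_iota 1?ltnW // nth_iota 1?ltnW.
Qed.

End Geodesics.

(** * Rays towards the boundary point and the level function *)

Section Boundary.
Context {q : nat} {T : homTree q} {omega : boundary T}.
Implicit Types (x y z : T) (g h : nat -> T).

Lemma rays_is_ray g : rays omega g -> is_ray g.
Proof. by have [g0 _ ->] := raysP omega; case. Qed.

Lemma rays_equiv g h : rays omega g -> rays omega h ->
  exists a b, forall k, g (a + k)%N = h (b + k)%N.
Proof.
have [g0 _ ->] := raysP omega; move=> /= [_ [m [n g0g]]] [_ [m' [n' g0h]]].
exists (n + m')%N, (n' + m)%N => k.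
by rewrite -!addnA -g0g addnCA g0h.
Qed.

Lemma rays_shift g : rays omega g -> rays omega (fun n => g n.+1).
Proof.
have [g0 _ ->] := raysP omega; move=> /= [ray_g [m [n g0g]]]; split.
  exact: (ray_shift g 1).
by exists m.+1, n => k; rewrite addSnnS g0g addnS.
Qed.

Lemma rays_cons x g : rays omega g -> adj x (g 0%N) -> x <> g 1%N ->
  rays omega (cons_ray x g).
Proof.
have [g0 _ ->] := raysP omega; move=> /= [ray_g [m [n g0g]]] adj_x x_neq; split.
  exact: ray_cons.
by exists m, n.+1.
Qed.

(** One can walk from [x] to a given ray of the class; each step backwards
    along this walk either extends the ray or shortens it. *)
Lemma ray_from x : exists2 g, rays omega g & g 0%N = x.
Proof.
have [g omega_g] : exists g, rays omega g.
  have [g ray_g ->] := raysP omega; exists g; split => //.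
  by exists 0%N, 0%N.
have [p] := adj_connected x (g 0%N).
elim: p x => [|y p IH] x /=; first by move=> _ ->; exists g.
move=> /andP[adj_xy /IH{}IH] /IH[h omega_h h0].
have [->|x_neq] := pselect (x = h 1%N).
  by exists (fun n => h n.+1) => //; exact: rays_shift.
by exists (cons_ray x h) => //; apply: rays_cons => //; rewrite h0.
Qed.

Lemma geodP x : rays omega (geod omega x) /\ geod omega x 0%N = x.
Proof.
have [g omega_g g0] := ray_from x.
apply: (xgetPex (fun=> x) (P := [set g | rays omega g /\ g 0%N = x])).
by exists g.
Qed.

Lemma geod_rays x : rays omega (geod omega x).
Proof. by have [] := geodP x. Qed.

Lemma geod0 x : geod omega x 0%N = x.
Proof. by have [] := geodP x. Qed.

Lemma geod_ray x : is_ray (geod omega x).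
Proof. exact: rays_is_ray (geod_rays x). Qed.

Lemma geod_unique g : rays omega g -> geod omega (g 0%N) =1 g.
Proof.
move=> omega_g.
have [a [b tails]] := rays_equiv _ _ (geod_rays (g 0%N)) omega_g.
apply: equiv_ray_unique tails; last exact: geod0.
  exact: geod_ray.
exact: rays_is_ray omega_g.
Qed.

Lemma tle_refl x : tle omega x x.
Proof. by exists 0%N => //; exact: geod0. Qed.

(** Only one of the [q + 1 >= 2] neighbours of [x] lies on the ray from [x];
    the ray from any other one starts through [x]. *)
Lemma tle_exists_lt x : (1 <= q)%N -> exists2 y, y <> x & tle omega y x.
Proof.
move=> q_ge1; have := geodP x; set h := geod omega x => -[omega_h h0].
have [y adj_xy y_neq] : exists2 y, adj x y & y <> h 1%N.
  apply: contrapT => no_other.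
  have sub1 : [set y | adj x y] `<=` [set h 1%N].
    by move=> y /= xy; apply: contrapT => y_neq; apply: no_other; exists y.
  have : (`I_q.+1 #<= `I_1)%card.
    rewrite -(card_le_eql (adj_degree x)) -(card_le_eqr (@card_set1 _ (h 1%N))).
    exact: subset_card_le.
  by rewrite card_le_II ltnS leqNgt q_ge1.
exists y; first by move=> yx; rewrite yx adj_irr in adj_xy.
have omega_yh : rays omega (cons_ray y h).
  by apply: rays_cons => //; rewrite h0; rewrite (adj_sym y).
by exists 1%N => //; rewrite (geod_unique _ omega_yh 1%N).
Qed.

Context {R : realType} {o : T}.

(** Since the rays from [x] and from [o] merge, the sequence defining the level
    is eventually constant, and moving [x] by [n] along its ray shortens by [n]
    the distance to every remote vertex of the ray from [o]. *)
Lemma level_geod x n :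
  level R omega o (geod omega x n) = level R omega o x + n%:R.
Proof.
have [a [b tails]] := rays_equiv _ _ (geod_rays o) (geod_rays x).
have level_at m : level R omega o (geod omega x m) = a%:R - b%:R + m%:R.
  apply: lim_near_cst; first exact: Rhausdorff.
  exists (a + m)%N => // j /= le_j.
  have [k ->] : exists k, j = (a + (m + k))%N.
    by exists (j - (a + m))%N; rewrite addnA subnKC.
  rewrite tails geod_ray (addnCA b) distnEr ?leq_addr //.
  by rewrite addKn !natrD; ring.
by rewrite -{2}[x]geod0 !level_at addr0.
Qed.

Lemma level_tle x z : tle omega x z -> level R omega o x <= level R omega o z.
Proof. by move=> [n _ <-]; rewrite level_geod lerDl. Qed.

(** * The smallest Gromov distance from a vertex *)

(** A confluent of [x] and [y] lies above [x], and so has at least its level;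
    [x] itself is the default value of [confluent]. *)
Lemma gromov_ge x y : x <> y ->
  expR (level R omega o x) <= gromov R omega o x y.
Proof.
move=> /eqP x_neq; rewrite /gromov (negbTE x_neq) ler_expR /confluent.
by case: xgetP => // z _ [/level_tle].
Qed.

(** Below [x], the bound is attained, because [x] is itself a common upper
    bound. *)
Lemma gromov_tle x y : x <> y -> tle omega y x ->
  gromov R omega o x y = expR (level R omega o x).
Proof.
move=> x_neq le_yx; apply/eqP; rewrite eq_le gromov_ge // andbT.
move/eqP: x_neq => x_neq; rewrite /gromov (negbTE x_neq) ler_expR /confluent.
by case: xgetP => // z _ [_ _]; apply => //; exact: tle_refl.
Qed.

Lemma gromov_eq0 x y : (gromov R omega o x y == 0) = (x == y).
Proof.
by rewrite /gromov; case: (x == y); rewrite ?eqxx // gt_eqF // expR_gt0.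
Qed.

(** * Bilipschitz maps move levels by a bounded amount *)

Lemma bilipschitz_inj (C : R) (f : T -> T) :
  bilipschitz omega o C f -> injective f.
Proof.
move=> [_ f_bilip] x y fxy; apply/eqP; rewrite -gromov_eq0 eq_le.
have := f_bilip x y; have /eqP -> : gromov R omega o (f x) (f y) == 0.
  by rewrite gromov_eq0 fxy.
by rewrite !mulr0 andbC.
Qed.

(** The exponential of the level of [x] is the minimum of the distances from
    [x] to other vertices. A minimizer for [x] is mapped to a competitor for
    [f x], and a minimizer for [f x] is the image of a competitor for [x]. *)
Lemma bilipschitz_level (C : R) (f : T -> T) x : (1 <= q)%N ->
  bilipschitz omega o C f ->
  - C <= level R omega o x - level R omega o (f x) <= C.
Proof.
move=> q_ge1 f_bilip; have f_inj := bilipschitz_inj _ _ f_bilip.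
case: f_bilip => f_surj f_bilip; apply/andP; split.
  have [y y_neq le_yx] := tle_exists_lt x q_ge1.
  have /andP[+ _] := f_bilip x y.
  rewrite (gromov_tle x) // => [/(le_trans _) lip|/esym//].
  rewrite lerBrDr -ler_expR expRD; apply: lip.
  rewrite ler_pM2l ?expR_gt0 //; apply: gromov_ge.
  by move=> /f_inj/esym.
have [y' y_neq le_yfx] := tle_exists_lt (f x) q_ge1.
have [y fy] := f_surj y'; subst y'.
have /andP[_] := f_bilip x y.
rewrite (gromov_tle (f x)) // => [/(le_trans _) lip|/esym//].
rewrite lerBlDr -ler_expR expRD; apply: lip.
by apply: gromov_ge => xy; rewrite xy in y_neq.
Qed.

End Boundary.

(** * Weights bounded above and below *)

Section Weights.
Context {R : realType} {q : nat} {T : homTree q}.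
Context {omega : boundary T} {o : T}.
Implicit Types (u w : T -> R) (E : set T) (M p beta : R).

Lemma mu_gt0 x : (1 <= q)%N -> 0 < mu R omega o x.
Proof. by move=> q_ge1; rewrite powR_gt0 // ltr0n. Qed.

Lemma mu_ge0 x : 0 <= mu R omega o x.
Proof. exact: powR_ge0. Qed.

Local Open Scope ereal_scope.

Lemma mu_set_ge0 E : 0 <= mu_set R omega o E.
Proof. by apply: esum_ge0 => x _; rewrite lee_fin mu_ge0. Qed.

Lemma average_ge0 u E : (forall x, 0 <= u x)%R -> 0 <= average omega o u E.
Proof.
move=> u_ge0; apply: mule_ge0; first by rewrite inve_ge0 mu_set_ge0.
by apply: esum_ge0 => x _; rewrite lee_fin mulr_ge0 // mu_ge0.
Qed.

(** The bound survives the degenerate cases: if [mu_set E] is [0] then so is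
    the sum, and if it is infinite then its inverse is [0]. *)
Lemma average_le u E M : (0 <= M)%R -> (forall x, 0 <= u x <= M)%R ->
  average omega o u E <= M%:E.
Proof.
move=> M_ge0 u_le; rewrite /average.
have mass_ge0 := mu_set_ge0 E.
have sum_ge0 : 0 <= \esum_(y in E) (u y * mu R omega o y)%:E.
  apply: esum_ge0 => x _; have /andP[u_ge0 _] := u_le x.
  by rewrite lee_fin mulr_ge0 // mu_ge0.
have sum_le : \esum_(y in E) (u y * mu R omega o y)%:E
              <= M%:E * mu_set R omega o E.
  apply: ge_ereal_sup => _ [X X_E <-].
  apply: (@le_trans _ _ (M%:E * \sum_(y \in X) (mu R omega o y)%:E)).
    rewrite ge0_mule_fsumr; last by move=> y; rewrite lee_fin mu_ge0.
    have [X_fin _] := X_E; rewrite !fsbig_finite //=.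
    apply: lee_sum => y _; have /andP[_ u_leM] := u_le y.
    by rewrite -EFinM lee_fin ler_wpM2r // mu_ge0.
  rewrite lee_wpmul2l ?lee_fin //.
  by apply: esum_ge; exists X.
move: mass_ge0 sum_ge0 sum_le; case: (mu_set R omega o E) => [m| |] //=.
- rewrite lee_fin le_eqVlt => /predU1P[<-|m_gt0] sum_ge0 sum_le.
    have -> : \esum_(y in E) (u y * mu R omega o y)%:E = 0.
      by apply/eqP; rewrite eq_le sum_ge0 andbT; move: sum_le; rewrite mule0.
    by rewrite mule0 lee_fin.
  rewrite inver gt_eqF // lee_pdivrMl //.
  by rewrite muleC.
- by move=> _ _ _; rewrite invey mul0e lee_fin.
Qed.

Lemma bounded_in_Loo u M : (forall x, 0 <= u x <= M)%R -> in_Loo u.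
Proof.
move=> u_le; apply: (@le_lt_trans _ _ M%:E); last exact: ltry.
apply: ge_ereal_sup => _ [x _ <-]; have /andP[u_ge0 u_leM] := u_le x.
by rewrite lee_fin ger0_norm.
Qed.

Lemma bounded_A1 beta w M : positive_weight w ->
  (forall x, w x <= M)%R -> (forall x, (w x)^-1 <= M)%R ->
  A1 omega o beta w.
Proof.
move=> w_gt0 w_le wV_le; split=> //.
have M_ge0 : (0 <= M)%R by apply: le_trans (w_le o); exact: ltW.
apply: (@le_lt_trans _ _ (M%:E * M%:E)); last exact: ltry.
apply: ge_ereal_sup => _ [E _ <-].
have avg_ge0 : 0 <= average omega o w E.
  by apply: average_ge0 => x; exact: ltW.
apply: (@le_trans _ _ (average omega o w E * M%:E)).
  apply: lee_wpmul2l => //; apply: ge_ereal_sup => _ [x _ <-].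
  by rewrite lee_fin ger0_norm ?invr_ge0 // ltW.
apply: lee_wpmul2r; rewrite ?lee_fin //.
by apply: average_le => // x; rewrite w_le ltW.
Qed.

(** The dual weight [w `^ (- (p - 1)^-1)] is a positive power of [w^-1], and so
    inherits an upper bound from it. *)
Lemma bounded_Ar beta p w M : (1 < p)%R -> positive_weight w ->
  (forall x, w x <= M)%R -> (forall x, (w x)^-1 <= M)%R ->
  Ar omega o beta p w.
Proof.
move=> p_gt1 w_gt0 w_le wV_le; split=> //.
have M_ge0 : (0 <= M)%R by apply: le_trans (w_le o); exact: ltW.
have p1_gt0 : (0 < p - 1)%R by rewrite subr_gt0.
set a := ((p - 1)^-1)%R; have a_ge0 : (0 <= a)%R by rewrite invr_ge0 ltW.
apply: (@le_lt_trans _ _ (M%:E * (M `^ a)%:E `^ (p - 1))); last first.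
  by rewrite poweR_EFin -EFinM ltry.
apply: ge_ereal_sup => _ [E _ <-].
apply: lee_pmul; first by apply: average_ge0 => x; exact: ltW.
- exact: poweR_ge0.
- by apply: average_le => // x; rewrite w_le ltW.
have dual_ge0 x : (0 <= w x `^ (- a))%R by exact: powR_ge0.
apply: gt0_ler_poweR; first exact: ltW.
- by rewrite in_itv /= leey andbT average_ge0.
- by rewrite in_itv /= leey andbT lee_fin powR_ge0.
apply: average_le => [|x]; first exact: powR_ge0.
rewrite dual_ge0 /= powRN -(powR_inv1 (powR_ge0 (w x) a)) powRAC.
rewrite powR_inv1; last exact: ltW.
by apply: ge0_ler_powR; rewrite // nnegrE // invr_ge0 ltW.
Qed.

Lemma bounded_Ap beta (p : \bar R) w M : 1 <= p -> positive_weight w ->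
  (forall x, w x <= M)%R -> (forall x, (w x)^-1 <= M)%R ->
  Ap omega o beta p w.
Proof.
move=> p_ge1 w_gt0 w_le wV_le; case: p p_ge1 => [r| |] //=.
- rewrite lee_fin => r_ge1; have [r1|r_neq1] := eqVneq r 1%R.
    exact: (bounded_A1 beta w M).
  by apply: (bounded_Ar beta r w M) => //; rewrite lt_def r_neq1 r_ge1.
- have lt12 : (1 < 2 :> R)%R by rewrite ltr1n.
  by exists 2%R => //; exact: (bounded_Ar beta 2 w M).
Qed.

End Weights.

(** * The Jacobian *)

Section Jacobian.
Context {R : realType} {q : nat} {T : homTree q}.
Context {omega : boundary T} {o : T}.
Local Notation level := (level R omega o).
Local Notation J := (flow_jacobian R omega o).

Lemma flow_jacobianE (f : T -> T) x : (1 <= q)%N ->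
  J f x = q%:R `^ (level (f x) - level x).
Proof.
move=> q_ge1; rewrite /flow_jacobian /mu powRB //.
by rewrite pnatr_eq0 -lt0n q_ge1 implybT.
Qed.

Lemma flow_jacobianVE (f : T -> T) x : (1 <= q)%N ->
  (J f x)^-1 = q%:R `^ (level x - level (f x)).
Proof. by move=> q_ge1; rewrite flow_jacobianE // -powRN opprB. Qed.

End Jacobian.

Theorem proposition4p3 (R : realType) (q : nat) (q_ge1 : (1 <= q)%N)
    (T : homTree q) (omega : boundary T) (o : T)
    (beta : R) (beta_ge12 : 12 <= beta)
    (f : T -> T) (C : R) (f_bilip : bilipschitz omega o C f) :
  (forall x : T, - C <= level R omega o x - level R omega o (f x) <= C) /\
  in_Loo (flow_jacobian R omega o f) /\
  in_Loo (fun x => (flow_jacobian R omega o f x)^-1) /\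
  forall p : \bar R, (1 <= p)%E -> Ap omega o beta p (flow_jacobian R omega o f).
Proof.
have level_bound x : - C <= level R omega o x - level R omega o (f x) <= C.
  exact: bilipschitz_level.
have q_ge1R : 1 <= q%:R :> R by rewrite ler1n.
have J_gt0 x : 0 < flow_jacobian R omega o f x.
  by rewrite divr_gt0 // mu_gt0.
have J_le x : flow_jacobian R omega o f x <= q%:R `^ C.
  rewrite flow_jacobianE // ler_powR // -opprB lerNl.
  by have /andP[] := level_bound x.
have JV_le x : (flow_jacobian R omega o f x)^-1 <= q%:R `^ C.
  by rewrite flow_jacobianVE // ler_powR //; have /andP[] := level_bound x.
split; first exact: level_bound.
split; [|split].
- by apply: (bounded_in_Loo _ (q%:R `^ C)) => x; rewrite J_le ltW.
- by apply: (bounded_in_Loo _ (q%:R `^ C)) => x; rewrite JV_le invr_ge0 ltW.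
- by move=> p p_ge1; apply: (bounded_Ap _ _ _ (q%:R `^ C)).
Qed.
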